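(* Let $(E_n)_{n\in\mathbb{N}}$ be a betting sequence with drift certificate $(c_n)$, and let $C_t\in\mathbb{R}$ ($t\in\mathbb{N}$) be constants with $\sum_{n\le t}c_n\ge C_t$ $\mathbb{P}_1$-a.s. Assume there are constants $\sigma_n^2\in[0,\infty)$ with $$\varphi_n(s)\le\frac{\sigma_n^2s^2}{2}\qquad\mathbb{P}_1\text{-a.s., for every }n\in\mathbb{N}\text{ and }s\ge0,$$ and let $V_t\ge\sum_{n\le t}\sigma_n^2$ be constants. Then, with $s_{\max}=\infty$: 1. $\psi_n(s)=\sigma_n^2s^2/2$ is a majorant, and $(C_t,\Psi^{(t)})$ with $\Psi^{(t)}(s)=V_ts^2/2$ is an aggregate. The rate function is $(\Psi^{(t)})^{\star}(x)=\frac{x^2}{2V_t}$ for $x\ge0$, and (for $V_t>0$) the optimising tilt at $x=\Delta_t$ is $s_t^{\ast}=\Delta_t/V_t$. 2. For every $t\in\mathbb{N}$ and $\alpha\in(0,1)$, $\ \bar\gamma_t(\alpha)\le\gamma_t(\alpha)\le\exp\big(-\frac{\Delta_t^2}{2V_t}\big)$. 3. For every constant $s>0$ and $\delta\in(0,1)$, with $\mathbb{P}_1$-probability at least $1-\delta$, simultaneously for all $t\in\mathbb{N}_0$, $$\log W_t>C_t-\frac{sV_t}{2}-\frac{\log\frac1\delta}{s}.$$ 4. If $c_n\equiv c>0$ and $\sigma_n^2\equiv\sigma^2$ are constant, then for every $\alpha,\delta\in(0,1)$, $$\mathbb{P}_1\Big(\tau_\alpha\le\Big\lceil\frac{2\ell}{c}+\frac{2\sigma^2}{c^2}\log\frac1\delta\Big\rceil\Big)\ge1-\delta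 .$$
   Context: Conventions: $\log$ is natural, $\log0=-\infty$; $(x)_+=\max\{x,0\}$; $C_0=V_0=0$; if $V_t=0$, then $\frac{x^2}{2V_t}$ is read as $+\infty$ for $x>0$ and $0$ for $x=0$, and $e^{-\infty}=0$. Setting: $(\Omega,\mathcal{F})$ is a measurable space with a filtration $(\mathcal{F}_t)_{t\in\mathbb{N}_0}$, $\mathcal{F}_0=\{\emptyset,\Omega\}$, and $\mathbb{P}_0,\mathbb{P}_1$ are probability measures with $\mathbb{P}_1|_{\mathcal{F}_t}\ll\mathbb{P}_0|_{\mathcal{F}_t}$ for all $t$. A betting sequence is a family of $\mathcal{F}_n$-measurable maps $E_n:\Omega\to[0,\infty]$ with $\mathbb{E}_{\mathbb{P}_0}[E_n\mid\mathcal{F}_{n-1}]\le1$ $\mathbb{P}_0$-a.s. Wealth: $W_0=1$, $W_t=\prod_{n\le t}E_n$; $L_n:=\log E_n$. For $\alpha\in(0,1)$: $\ell:=\log\frac1\alpha$, $\tau_\alpha:=\inf\{t\in\mathbb{N}:W_t>\frac1\alpha\}$, $\gamma_t(\alpha):=\mathbb{P}_1(W_t\le\frac1\alpha)$, $\bar\gamma_t(\alpha):=\mathbb{P}_1(\tau_\alpha>t)$; $\Delta_t:=(C_t-\ell)_+$. Drift certificate: real random variables $c_n$, $\mathcal{F}_{n-1}$-measurable, with $\mathbb{E}_{\mathbb{P}_1}[L_n\mid\mathcal{F}_{n-1}]\ge c_n$ $\mathbb{P}_1$-a.s. (conditional expectation in the extended sense, required to be well defined). Put $\varphi_n(s):=\log\mathbb{E}_{\mathbb{P}_1}[e^{-s(L_n-c_n)}\mid\mathcal{F}_{n-1}]$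 for $s\ge0$. Majorant on $[0,s_{\max})$: maps $\psi_n:[0,s_{\max})\times\Omega\to[0,\infty]$ with $\psi_n(s)$ $\mathcal{F}_{n-1}$-measurable, $\psi_n(0)=0$, and $\varphi_n(s)\le\psi_n(s)$ $\mathbb{P}_1$-a.s. for all $n$, $s$. Aggregate: deterministic $C_t$, $\Psi^{(t)}$ with $\sum_{n\le t}c_n\ge C_t$ and $\sum_{n\le t}\psi_n(s)\le\Psi^{(t)}(s)$ $\mathbb{P}_1$-a.s. for all $t$ and $s\in[0,s_{\max})$. Rate function: $(\Psi^{(t)})^{\star}(x):=\sup_{s\in[0,s_{\max})}\{sx-\Psi^{(t)}(s)\}$, $x\ge0$; the optimising tilt is a maximiser of this supremum at $x=\Delta_t$. *)

(* Defs.v *)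
From HB Require Import structures.
From mathcomp Require Export all_boot all_order all_algebra.
From mathcomp Require Export all_classical all_reals all_analysis.
From mathcomp Require Export measurable_realfun.

Set Implicit Arguments.
Unset Strict Implicit.
Unset Printing Implicit Defensive.

Import Order.TTheory GRing.Theory Num.Theory.
Import numFieldNormedType.Exports.

Local Open Scope classical_set_scope.
Local Open Scope ring_scope.
Local Open Scope ereal_scope.

Section conditional_expectation.
Context (R : realType) (d : measure_display) (T : measurableType d).
Implicit Types (P : probability T R) (G : set (set T)) (X Y : T -> \bar R).

(* [G] is meant to be a sigma-algebra, so that <<s G >> = G. *)
Definition G_measurable d' (U : measurableType d') G (f : T -> U) :=
  measurable_fun [set: g_sigma_algebraType G] (f : g_sigma_algebraType G -> U).

Definition ge0_cond_exp_version P G X Y :=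
  [/\ G_measurable G Y, (forall w, 0 <= Y w) &
      forall A, G A -> \int[P]_(w in A) Y w = \int[P]_(w in A) X w].

(* For X >= 0; a version exists by [ge0_cond_expP] below, so the default
   value is never used for such X. *)
Definition ge0_cond_exp P G X : T -> \bar R :=
  xget (cst 0) [set Y | ge0_cond_exp_version P G X Y].

(* The extended conditional expectation E[X^+ | G] - E[X^- | G], and the
   requirement that it is almost surely not of the form +oo - +oo. *)
Definition cond_exp P G X : T -> \bar R := fun w =>
  ge0_cond_exp P G (X ^\+) w - ge0_cond_exp P G (X ^\-) w.

Definition cond_exp_defined P G X :=
  {ae P, forall w,
    adde_def (ge0_cond_exp P G (X ^\+) w) (- ge0_cond_exp P G (X ^\-) w)}.

End conditional_expectation.

Section ge0_cond_exp_exists.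
Context (R : realType) (d : measure_display) (T : measurableType d).
Variables (P : probability T R) (G : set (set T)).
Hypotheses (sG : sigma_algebra setT G) (GM : G `<=` @measurable d T).

Local Notation TG := (g_sigma_algebraType G).
Let to_G : T -> TG := fun w => w.

Let G_measurableP (A : set T) : (measurable : set (set TG)) A <-> G A.
Proof. by rewrite -[X in _ <-> X A](sigma_algebra_id sG). Qed.

Let measurable_to_G : measurable_fun setT to_G.
Proof. by move=> _ B mB; rewrite setTI; apply: GM; exact/G_measurableP. Qed.

Definition restricted_prob (A : set TG) : \bar R := P A.

Let PG0 : restricted_prob set0 = 0. Proof. exact: measure0. Qed.

Let PG_ge0 A : 0 <= restricted_prob A. Proof. exact: measure_ge0. Qed.

Let PG_sigma_additive : semi_sigma_additive restricted_prob.
Proof.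
move=> F mF tF mUF; apply: (@measure_semi_sigma_additive _ _ _ P) => //.
- by move=> i; apply: GM; exact/G_measurableP.
- by apply: GM; exact/G_measurableP.
Qed.

HB.instance Definition _ :=
  isMeasure.Build _ _ _ restricted_prob PG0 PG_ge0 PG_sigma_additive.

Let PGT : restricted_prob setT = 1. Proof. exact: probability_setT. Qed.

HB.instance Definition _ := Measure_isProbability.Build _ _ _ restricted_prob PGT.

Section bounded.
Variable X : T -> R.
Hypotheses (mX : measurable_fun setT X) (X0 : forall w, (0 <= X w)%R).
Hypothesis (X1 : forall w, (X w <= 1)%R).

Definition restricted_density (A : set TG) : \bar R := \int[P]_(w in A) (X w)%:E.

Let nu0 : restricted_density set0 = 0. Proof. by rewrite /restricted_density integral_set0. Qed.

Let nu_ge0 A : 0 <= restricted_density A.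
Proof. by apply: integral_ge0 => w _; rewrite lee_fin. Qed.

Let nu_sigma_additive : semi_sigma_additive restricted_density.
Proof.
move=> F mF tF mUF; apply: (@semi_sigma_additive_nng_induced _ _ _ P) => //.
- exact/measurable_EFinP.
- by move=> i; apply: GM; exact/G_measurableP.
- by apply: GM; exact/G_measurableP.
Qed.

HB.instance Definition _ :=
  isMeasure.Build _ _ _ restricted_density nu0 nu_ge0 nu_sigma_additive.

Let nu_fin : fin_num_fun restricted_density.
Proof.
move=> A /G_measurableP/GM mA; rewrite ge0_fin_numE//.
apply: (@le_lt_trans _ _ (\int[P]_(w in A) 1)); last first.
  rewrite integral_cst// mul1e (@le_lt_trans _ _ 1) ?ltry//.
  exact: probability_le1.
apply: ge0_le_integral => //=.
- by move=> w _; rewrite lee_fin.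
- by apply/measurable_EFinP; exact: measurable_funTS.
- by move=> w _; rewrite lee_fin.
Qed.

HB.instance Definition _ := Measure_isFinite.Build _ _ _ restricted_density nu_fin.

Lemma bounded_cond_exp : exists Y : T -> \bar R,
  ge0_cond_exp_version P G (EFin \o X) Y.
Proof.
have nuPG : restricted_density `<< restricted_prob.
  apply/null_content_dominatesP => A /G_measurableP/GM mA PA0.
  apply: null_set_integral => //.
  by apply/measurable_EFinP/measurable_funTS.
have [Y [Y0 _ /integrableP[mY _] YE]] := radon_nikodym_sigma_finite nuPG.
exists Y; split => // A GA.
have mA : measurable (A : set TG) by exact/G_measurableP.
rewrite -[RHS]/(restricted_density A) YE//; apply/esym.
apply: (ge0_integral_pushforward measurable_to_G P mA) => //.
exact: measurable_funTS.
Qed.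

End bounded.

Lemma ge0_cond_exp_exists X :
  measurable_fun setT X -> (forall w, 0 <= X w) ->
  exists Y, ge0_cond_exp_version P G X Y.
Proof.
move=> mX X0.
pose m k w : R := fine (mine (X w) k%:R%:E).
have mE k w : (m k w)%:E = mine (X w) k%:R%:E.
  rewrite fineK// ge0_fin_numE; last by rewrite le_min X0 lee_fin /=.
  by rewrite gt_min ltry orbT.
pose Z k w : R := (m k.+1 w - m k w)%R.
have mm : forall k, measurable_fun [set: T] (m k).
  by move=> k; apply: measurableT_comp => //; exact: measurable_mine.
have mZ : forall k, measurable_fun [set: T] (Z k).
  by move=> k; exact: measurable_funB.
have Z0 k w : (0 <= Z k w)%R.
  rewrite subr_ge0 -lee_fin !mE le_min ge_min lexx/= ge_min.
  by rewrite !lee_fin ler_nat leqnSn orbT.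
have Z1 k w : (Z k w <= 1)%R.
  rewrite lerBlDl -lee_fin EFinD !mE; have [Xk|kX] := leP (X w) k%:R%:E.
    by rewrite ge_min leeDl.
  by rewrite ge_min -EFinD lee_fin natr1 lexx orbT.
have ZX w : \sum_(k <oo) (Z k w)%:E = X w.
  apply: cvg_lim => //.
  under eq_fun => n.
    rewrite sumEFin telescope_sumr// EFinB !mE.
    rewrite [mine _ 0%:R%:E]min_r ?X0// sube0; over.
  move: (X w) (X0 w) => [r _| _|//].
    apply: cvg_near_cst; near=> n; apply: min_l; rewrite lee_fin.
    by near: n; exact: nbhs_infty_ger.
  under eq_fun => n do rewrite min_r ?leey//.
  exact/cvgenyP.
have /choice[Y YP] : forall k, exists Y,
    ge0_cond_exp_version P G (EFin \o Z k) Y.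
  by move=> k; exact: bounded_cond_exp.
exists (fun w => \sum_(k <oo) Y k w); split.
- apply: ge0_emeasurable_sum => [k w _ _|k _]; first by have [_ ->] := YP k.
  by have [] := YP k.
- by move=> w; apply: nneseries_ge0 => k _ _; have [_ ->] := YP k.
move=> A GA; have mA := GM GA.
rewrite integral_nneseries//; last 2 first.
- move=> k; apply: measurable_funTS; have [mY _ _] := YP k.
  exact: (measurableT_comp mY measurable_to_G).
- by move=> k w _; have [_ ->] := YP k.
under [RHS]eq_integral do rewrite -ZX.
rewrite integral_nneseries//; last 2 first.
- by move=> k; apply/measurable_EFinP; exact: measurable_funTS.
- by move=> k w _; rewrite lee_fin.
by apply: eq_eseriesr => k _; have [_ _ ->] := YP k.
Unshelve. all: by end_near. Qed.

Lemma ge0_cond_expP X :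
  measurable_fun setT X -> (forall w, 0 <= X w) ->
  ge0_cond_exp_version P G X (ge0_cond_exp P G X).
Proof. by move=> mX X0; apply: xgetPex; exact: ge0_cond_exp_exists. Qed.

End ge0_cond_exp_exists.

(* Sequences indexed by n = 1, 2, ... are total functions on nat whose value
   at 0 is never used; F_{n-1} at time n.+1 is [F n]. *)
Section betting.
Context (R : realType) (d : measure_display) (T : measurableType d).
Implicit Types (P : probability T R) (F : nat -> set (set T)).
Implicit Types (E : nat -> T -> \bar R) (c : nat -> T -> R).
Implicit Types (psi : nat -> R -> T -> \bar R) (C V : nat -> R).
Implicit Types (Psi : nat -> R -> \bar R) (smax : \bar R).
Implicit Types (alpha s x : R) (n t : nat) (w : T).

Definition filtration F :=
  [/\ forall n, sigma_algebra setT (F n),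
      forall n, F n `<=` @measurable d T,
      forall m n, (m <= n)%N -> F m `<=` F n &
      F 0%N = [set set0; setT]].

Definition locally_dominated F P1 P0 :=
  forall t A, F t A -> P0 A = 0 -> P1 A = 0.

Definition betting_sequence P0 F E := forall n,
  [/\ G_measurable (F n.+1) (E n.+1),
      forall w, 0 <= E n.+1 w &
      {ae P0, forall w, ge0_cond_exp P0 (F n) (E n.+1) w <= 1}].

Definition wealth E t w : \bar R := \prod_(1 <= n < t.+1) E n w.

Definition logE E n w : \bar R := lne (E n w).

Definition drift_certificate P1 F E c := forall n,
  [/\ G_measurable (F n) (c n.+1),
      cond_exp_defined P1 (F n) (logE E n.+1) &
      {ae P1, forall w, (c n.+1 w)%:E <= cond_exp P1 (F n) (logE E n.+1) w}].

(* The integrand is +oo where [logE E n w = -oo] and s > 0, 0 where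
   [logE E n w = +oo] and s > 0, and 1 for s = 0 since 0 * +-oo = 0. *)
Definition phi P1 F E c n s : T -> \bar R := fun w =>
  lne (ge0_cond_exp P1 (F n.-1)
    (fun v => expeR (- (s%:E * (logE E n v - (c n v)%:E)))) w).

Definition tilts smax : set R := [set s | (0 <= s)%R /\ s%:E < smax].

Definition majorant P1 F E c smax psi := forall n,
  (forall w, psi n.+1 0%R w = 0) /\
  (forall s, tilts smax s ->
     [/\ forall w, 0 <= psi n.+1 s w,
         G_measurable (F n) (psi n.+1 s) &
         {ae P1, forall w, phi P1 F E c n.+1 s w <= psi n.+1 s w}]).

Definition drift_lower_bound P1 c C := forall t,
  {ae P1, forall w, (C t <= \sum_(1 <= n < t.+1) c n w)%R}.

Definition aggregate P1 c smax psi C Psi :=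
  drift_lower_bound P1 c C /\
  (forall t s, tilts smax s ->
     {ae P1, forall w, \sum_(1 <= n < t.+1) psi n s w <= Psi t s}).

Definition rate smax (Psi_t : R -> \bar R) x : \bar R :=
  ereal_sup [set (s * x)%:E - Psi_t s | s in tilts smax].

Definition optimising_tilt smax (Psi_t : R -> \bar R) x s :=
  tilts smax s /\
  (forall s', tilts smax s' ->
     (s' * x)%:E - Psi_t s' <= (s * x)%:E - Psi_t s).

(* x^2 / (2 v) with its conventional value when v = 0. *)
Definition gaussian_rate (v x : R) : \bar R :=
  if v == 0%R then (if x == 0%R then 0 else +oo)
  else (x ^+ 2 / (2 * v))%:E.

(* inf of the empty set is +oo. *)
Definition stop_time E alpha w : \bar R :=
  ereal_inf [set t%:R%:E | t in
    [set t | (1 <= t)%N /\ (alpha^-1)%:E < wealth E t w]].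

Definition miss_prob P1 E t alpha : \bar R :=
  P1 [set w | wealth E t w <= (alpha^-1)%:E].

Definition stop_miss_prob P1 E t alpha : \bar R :=
  P1 [set w | t%:R%:E < stop_time E alpha w].

Definition excess C alpha t : R := Num.max (C t - ln (alpha^-1))%R 0%R.

End betting.

(* Main.v *)
(* The proof is a Chernoff argument made uniform in time. With X_n = e^{-s (L_n - c_n)}
   and E[X_n | F_{n-1}] <= e^{b_n}, where b_n = sigma_n^2 s^2 / 2, the process
   M_t = \prod_{n <= t} e^{-b_n} X_n is a nonnegative supermartingale under P_1
   started at 1, so by Ville's inequality it stays below 1/delta with probability
   at least 1 - delta. Since every E_n is a.s. positive, M_t equals
   exp (-s (log W_t - \sum c_n) - \sum b_n), and M_t < 1/delta is then the lower bound
   on log W_t of part 3. Taking delta = exp (-(s Delta_t - V_t s^2 / 2)) in part 3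
   bounds the miss probability for each s, and the supremum over s is the rate
   function, which gives part 2; part 4 is part 2 with C_t = c t and V_t = sigma^2 t. *)
Require Import Defs.

From mathcomp Require Import ring lra.

Set Implicit Arguments.
Unset Strict Implicit.
Unset Printing Implicit Defensive.

Import Order.TTheory GRing.Theory Num.Theory.
Import numFieldNormedType.Exports HBNNSimple.

Local Open Scope classical_set_scope.
Local Open Scope ring_scope.
Local Open Scope ereal_scope.

(** * Measurability of the extended exponential and logarithm *)

Lemma measurable_expeR (R : realType) :
  measurable_fun [set: \bar R] (@expeR R).
Proof.
(* [er_map expR] fixes -oo, where [expeR] is 0; the maximum with 0 corrects this. *)
rewrite (_ : @expeR R = fun x => maxe 0 (er_map expR x)).
  apply: measurable_maxe => //.
  by apply: (@measurable_er_map _ (measurableTypeR R)); exact: measurable_expR.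
apply/funext => -[r| |] /=; last 2 first.
- by rewrite max_r ?leey.
- by rewrite max_l ?leNye.
by rewrite max_r// lee_fin expR_ge0.
Qed.

Lemma measurable_lne (R : realType) : measurable_fun [set: \bar R] (@lne R).
Proof.
(* [ln] takes the default value 0 on nonpositive reals, where [lne] is -oo; hence the case split. *)
rewrite (_ : @lne R = fun x => if x <= 0 then -oo else er_map (@ln R) x).
  apply: measurable_fun_ifT => //.
    exact: measurable_fun_lee.
  by apply: (@measurable_er_map _ (measurableTypeR R)); exact: measurable_ln.
by apply/funext => -[r| |] //=; rewrite ?leye_eq ?leNye.
Qed.

(** * Measurability and integral comparison over a sub-sigma-algebra *)

Section sub_sigma_algebra_integral.
Context (R : realType) (d : measure_display) (T : measurableType d).
Implicit Types (G : set (set T)) (f g Z : T -> \bar R).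

Lemma G_measurableS d' (U : measurableType d') G G' (f : T -> U) :
  G `<=` G' -> G_measurable G f -> G_measurable G' f.
Proof.
move=> GG' mf _ B mB; have := mf measurableT B mB.
exact: (sub_sigma_algebra2 GG').
Qed.

Lemma G_measurable_measurable d' (U : measurableType d') G (f : T -> U) :
  G `<=` @measurable d T -> G_measurable G f -> measurable_fun setT f.
Proof.
move=> GM mf _ B mB; have := mf measurableT B mB.
move=> /(sub_sigma_algebra2 GM).
by rewrite (sigma_algebra_id (@sigma_algebra_measurable _ T)).
Qed.

Lemma G_measurable_preimage d' (U : measurableType d') G (f : T -> U) B :
  sigma_algebra setT G -> G_measurable G f -> measurable B -> G (f @^-1` B).
Proof.
move=> sG mf mB; rewrite -[G](sigma_algebra_id sG).
by have := mf measurableT B mB; rewrite setTI.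
Qed.

(* Z is G-measurable but f and g need not be, so Z is approximated by simple
   functions on the coarser space [g_sigma_algebraType G]. *)
Lemma le_integral_mul G (mu : {measure set T -> \bar R}) f g Z :
  sigma_algebra setT G -> G `<=` @measurable d T ->
  measurable_fun setT f -> (forall w, 0 <= f w) ->
  measurable_fun setT g -> (forall w, 0 <= g w) ->
  (forall A, G A -> \int[mu]_(w in A) f w <= \int[mu]_(w in A) g w) ->
  G_measurable G Z -> (forall w, 0 <= Z w) ->
  \int[mu]_w (Z w * f w) <= \int[mu]_w (Z w * g w).
Proof.
move=> sG GM mf f0 mg g0 fg mZ Z0.
pose hG := nnsfun_approx (@measurableT _ (g_sigma_algebraType G)) mZ.
pose h n : T -> R := fun w => hG n (w : g_sigma_algebraType G).
have h0 n w : (0 <= h n w)%R by exact: fun_ge0.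
have mh n : measurable_fun [set: T] (h n).
  by apply: (G_measurable_measurable GM); exact: measurable_funPT.
have hZ w : (h n w)%:E @[n --> \oo] --> Z w.
  by apply: (@cvg_nnsfun_approx _ (g_sigma_algebraType G)) => // v _; exact: Z0.
have nd w : {homo (fun n => (h n w)%:E) : m n / (m <= n)%N >-> m <= n}.
  by move=> m n mn; rewrite lee_fin;
    exact: (lefP _ _ (nd_nnsfun_approx
      (@measurableT _ (g_sigma_algebraType G)) mZ mn)).
have mono (f' : T -> \bar R) : measurable_fun setT f' -> (forall w, 0 <= f' w) ->
    \int[mu]_w ((h n w)%:E * f' w) @[n --> \oo] --> \int[mu]_w (Z w * f' w).
  move=> mf' f'0.
  rewrite (_ : (fun w => Z w * f' w) =
               fun w => limn (fun n => (h n w)%:E * f' w)); last first.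
    apply/funext => w; apply/esym/cvg_lim => //.
    (* Multiplication is not continuous at 0 times +oo, so zeros of either factor are treated apart.
       Where [Z] vanishes, so do its approximations, which lie between 0 and [Z]. *)
    have [f'w0|f'w0] := eqVneq (f' w) 0.
      by rewrite f'w0 mule0; under eq_fun do rewrite mule0; exact: cvg_cst.
    have [Zw0|Zw0] := eqVneq (Z w) 0.
      rewrite Zw0 mul0e; under eq_fun => n.
        rewrite (_ : (h n w)%:E = 0) ?mul0e; first over.
        apply/le_anti/andP; split; last by rewrite lee_fin.
        rewrite -Zw0 -(cvg_lim _ (hZ w))// (cvg_lim _ (ereal_nondecreasing_cvgn (nd w)))//.
        by apply: ereal_sup_ubound; exists n.
      exact: cvg_cst.
    apply: cvgeM => //; last exact: cvg_cst.
    by rewrite mule_defE (negbTE f'w0) (negbTE Zw0).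
  apply: (@cvg_monotone_convergence _ T _ mu _ measurableT
            (fun n w => (h n w)%:E * f' w)).
  - by move=> n; apply: emeasurable_funM => //; exact/measurable_EFinP.
  - by move=> n w _; rewrite mule_ge0// lee_fin.
  - by move=> w _ m n mn; rewrite lee_wpmul2r// nd.
have simple n (f' : T -> \bar R) : measurable_fun setT f' -> (forall w, 0 <= f' w) ->
    \int[mu]_w ((h n w)%:E * f' w) = \sum_(y \in range (h n))
       (y%:E * \int[mu]_(w in h n @^-1` [set y]) f' w).
  move=> mf' f'0.
  have mhy y : measurable (h n @^-1` [set y] : set T).
    by rewrite -[X in measurable X]setTI; exact: mh.
  have mind y : measurable_fun setT (fun w : T => \1_(h n @^-1` [set y]) w : R).
    exact: measurable_indic.
  transitivity (\int[mu]_w (\sum_(y \in range (h n))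
      ((y * \1_(h n @^-1` [set y]) w)%:E * f' w))).
    apply: eq_integral => w _.
    rewrite -ge0_mule_fsuml => [|y]; last first.
      exact: (@nnfun_muleindic_ge0 _ (g_sigma_algebraType G)).
    rewrite fsumEFin//; last exact: (fimfunP (hG n)).
    by congr (_%:E * _); exact: (fimfunE (hG n) w).
  rewrite ge0_integral_fsum//; last 3 first.
  - move=> y; apply: emeasurable_funM => //; apply/measurable_EFinP.
    exact: measurable_funM.
  - move=> y w _; rewrite mule_ge0//.
    exact: (@nnfun_muleindic_ge0 _ (g_sigma_algebraType G)).
  - exact: (fimfunP (hG n)).
  apply: eq_fsbigr => y; rewrite inE => -[v _ yE].
  under eq_integral do rewrite EFinM -muleA.
  rewrite ge0_integralZl//; last 3 first.
  - by apply: emeasurable_funM => //; exact/measurable_EFinP.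
  - by move=> w _; rewrite mule_ge0// lee_fin.
  - by rewrite lee_fin -yE.
  congr (_ * _); rewrite [RHS]integral_mkcond; apply: eq_integral => w _.
  by rewrite epatch_indic muleC.
apply: (lee_cvg_to (mono f mf f0) (mono g mg g0)).
apply: nearW => n; rewrite !simple//.
(* The level sets of [h n] belong to [G], so the hypothesis comparing [f] and [g] applies term by
   term. *)
apply: lee_fsum => [|y]; first exact: (fimfunP (hG n)).
move=> [v _ <-]; rewrite lee_wpmul2l ?lee_fin//.
apply: fg; apply: G_measurable_preimage => //.
exact: measurable_funPT.
Qed.

End sub_sigma_algebra_integral.

(** * Ville's maximal inequality *)

Section ville.
Context (R : realType) (d : measure_display) (T : measurableType d).
Variables (F : nat -> set (set T)) (mu : {measure set T -> \bar R}).
Variable (M : nat -> T -> \bar R).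
Hypotheses (hF : filtration F) (mM : forall n, G_measurable (F n) (M n)).
Hypothesis M0 : forall n w, 0 <= M n w.
(** The supermartingale property, integrated over events of [F n] so that conditional expectations
    of [M] do not enter. *)
Hypothesis superM : forall n A, F n A ->
  \int[mu]_(w in A) M n.+1 w <= \int[mu]_(w in A) M n w.
Variable lam : R.
Hypothesis lam_gt0 : (0 < lam)%R.

Let below N := [set w | forall k, (k <= N)%N -> M k w < lam%:E].

Let F_measurable n A : F n A -> measurable A.
Proof. by have [_ FM _ _] := hF; exact: FM. Qed.

Let F_below N : F N (below N).
Proof.
have [sF _ monoF _] := hF.
rewrite -[F N](sigma_algebra_id (sF N)).
rewrite -[<<s F N >> _]/(measurable (below N : set (g_sigma_algebraType (F N)))).
have -> : below N = \bigcap_(k in [set k | (k <= N)%N]) [set w | M k w < lam%:E].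
  by apply/seteqP; split => w /= H k; exact: H.
apply: bigcap_measurable => [|k kN]; first by exists 0%N.
have mk : G_measurable (F N) (M k) := G_measurableS (monoF _ _ kN) (@mM k).
have := emeasurable_fun_infty_o measurableT mk lam%:E.
by rewrite setTI.
Qed.

Let measurable_M n : measurable_fun setT (M n).
Proof. by have [_ FM _ _] := hF; exact: G_measurable_measurable (FM n) (@mM n). Qed.

Let belowS N : below N.+1 = below N `&` [set w | M N.+1 w < lam%:E].
Proof.
apply/seteqP; split => [w /= H|w /= [H HN] k].
  by split => [k kN|]; apply: H => //; exact: leqW.
by rewrite leq_eqVlt => /orP[/eqP->//|]; rewrite ltnS; exact: H.
Qed.

(* The first summand pays for the paths that have crossed [lam], the second is
   the mass still carried by those that have not. *)
Lemma ville_finite N :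
  lam%:E * mu (~` below N) + \int[mu]_(w in below N) M N w <= \int[mu]_w M 0%N w.
Proof.
have mB n : measurable (below n) := F_measurable (F_below n).
have lamM n D : measurable D -> (forall w, D w -> lam%:E <= M n w) ->
    lam%:E * mu D <= \int[mu]_(w in D) M n w.
  move=> mD lamD; rewrite -integral_cst//; apply: ge0_le_integral => //.
  - by move=> w _; rewrite /cst lee_fin ltW.
  - exact: measurable_funTS.
elim: N => [|N IH].
  rewrite -[leRHS]/(\int[mu]_(w in setT) M 0%N w) -(setvU (below 0%N)) ge0_integral_setU//.
  - rewrite leeD2r//; apply: lamM; first exact: measurableC.
    move=> w /= H; rewrite leNgt; apply/negP => wl; apply: H => k.
    by rewrite leqn0 => /eqP->.
  - exact: measurableC.
  - by rewrite setvU.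
  - by apply/disj_setPS => w [].
apply: le_trans IH.
(* The paths that first cross [lam] at time [N.+1]: they move from the second summand to the
   first. *)
set D := below N `&` [set w | lam%:E <= M N.+1 w].
have mD : measurable D.
  apply: measurableI => //; rewrite -[X in measurable X]setTI.
  exact: emeasurable_fun_c_infty.
have -> : ~` below N.+1 = ~` below N `|` D.
  rewrite belowS setCI /D; apply/seteqP; split => w /=.
    have [wB|wB] := pselect (below N w); last by left.
    by move=> [//|/negP]; rewrite -leNgt; right.
  by move=> [|[_ H]]; [left|right; apply/negP; rewrite -leNgt].
have -> : mu (~` below N `|` D) = mu (~` below N) + mu D.
  rewrite measureU//; first exact: measurableC.
  by apply/disjoints_subset; apply: subsetC => w [].
rewrite ge0_muleDr// -addeA leeD2l//.
(* [below N] is an event of [F N], so the supermartingale inequality applies on it. *)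
apply: le_trans (superM (F_below N)).
have -> : below N = D `|` below N.+1.
  rewrite belowS /D; apply/seteqP; split => w /=; last by move=> [[]|[]].
  by move=> wB; case: (leP lam%:E (M N.+1 w)) => H; [left|right].
rewrite ge0_integral_setU//.
- by rewrite leeD2r//; apply: lamM => // w [].
- exact: measurable_funTS.
- by apply/disj_setPS => w; rewrite belowS /D => -[[_ /= +] [_ /=]]; rewrite leNgt => /negP.
Qed.

(** The events of crossing up to time n increase to the event of ever crossing. By continuity from
    below, the finite-horizon bounds pass to the limit once their nonnegative second summand is
    dropped. *)
Lemma ville : lam%:E * mu [set w | exists n, lam%:E <= M n w] <= \int[mu]_w M 0%N w.
Proof.
have mC n : measurable (~` below n).
  exact/measurableC/(F_measurable (F_below n)).
have -> : [set w | exists n, lam%:E <= M n w] = \bigcup_n ~` below n.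
  apply/seteqP; split => [w [n lamn]|w [n _ /= H]].
    by exists n => //= /(_ n (leqnn n)); rewrite ltNge lamn.
  apply: contrapT => nH; apply: H => k _; rewrite ltNge; apply/negP => kl.
  by apply: nH; exists k.
have ndC : {homo (fun n => ~` below n) : m n / (m <= n)%N >-> (m <= n)%O}.
  move=> m n mn; apply/subsetPset/subsetC => w H k km.
  by apply: H; exact: leq_trans mn.
have cvgC := nondecreasing_cvg_mu mC (bigcup_measurable (fun n _ => mC n)) ndC.
have lam_fin : lam%:E \is a fin_num by [].
apply: (cvge_to_le (cvgeZl lam_fin (cvgC _ mu))).
apply: nearW => n; apply: le_trans (ville_finite n).
by rewrite leeDl// integral_ge0.
Qed.

End ville.

Lemma ae_le_measure (R : realType) (d : measure_display) (T : measurableType d)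
    (mu : {measure set T -> \bar R}) (A B : set T) :
  measurable A -> measurable B -> {ae mu, forall w, A w -> B w} -> mu A <= mu B.
Proof.
move=> mA mB [N [mN N0 subN]].
have -> : mu B = mu B + mu N by rewrite N0 adde0.
apply: (@le_trans _ _ (mu (B `|` N))); last exact: measureU2.
apply: le_measure; rewrite ?inE//.
  exact: measurableU.
move=> w Aw; have [Bw|nBw] := pselect (B w); [by left|right].
by apply: subN => /= /(_ Aw).
Qed.

Lemma lne_neqNy (R : realType) (x : \bar R) : 0 < x -> lne x != -oo.
Proof. by case: x => [r| |]//=; rewrite lte_fin leNgt => ->. Qed.

(** * The exponential supermartingale of the tilted log-wealth *)

Section tilted_wealth.
Context (R : realType) (d : measure_display) (T : measurableType d).
Variables (F : nat -> set (set T)) (P : probability T R).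
Variables (E : nat -> T -> \bar R) (c : nat -> T -> R) (s : R) (b : nat -> R).
Hypotheses (hF : filtration F) (s_gt0 : (0 < s)%R).
Hypothesis mE : forall n, G_measurable (F n.+1) (E n.+1).
Hypothesis E_ge0 : forall n w, 0 <= E n.+1 w.
Hypothesis mc : forall n, G_measurable (F n) (c n.+1).
Hypothesis phi_le : forall n, {ae P, forall w, phi P F E c n.+1 s w <= (b n.+1)%:E}.

Let X n w := expeR (- (s%:E * (logE E n w - (c n w)%:E))).

Let X_ge0 n w : 0 <= X n w. Proof. exact: expeR_ge0. Qed.

Let FM n : F n `<=` @measurable d T. Proof. by have [_ +] := hF; exact. Qed.

Let G_measurable_X n : G_measurable (F n.+1) (X n.+1).
Proof.
have [_ _ monoF _] := hF.
apply: (measurableT_comp (@measurable_expeR R)).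
apply: (@measurableT_comp _ _ _ _ _ _ (fun x : \bar R => - x)); first exact: oppe_measurable.
 apply: measurable_funeM.
apply: emeasurable_funB; first exact: (measurableT_comp (@measurable_lne R) (@mE n)).
apply/measurable_EFinP.
exact: (G_measurableS (monoF _ _ (leqnSn n)) (@mc n)).
Qed.

Let measurable_X n : measurable_fun setT (X n.+1).
Proof. exact: G_measurable_measurable (@FM n.+1) (@G_measurable_X n). Qed.

(** [phi] is the logarithm of the conditional expectation of [X n.+1], whose integrals over events
    of [F n] are those of [X n.+1] itself. *)
Let integral_X_le n A : F n A ->
  \int[P]_(w in A) X n.+1 w <= \int[P]_(w in A) (expR (b n.+1))%:E.
Proof.
have [sF _ _ _] := hF.
have [mY Y0 YX] := ge0_cond_expP P (sF n) (@FM n) (@measurable_X n) (@X_ge0 n.+1).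
move=> FA; rewrite -YX//; apply: ae_ge0_le_integral => //.
- exact: (@FM n).
- by apply: measurable_funTS; exact: G_measurable_measurable (@FM n) mY.
apply: filterS (phi_le n) => w + _.
have /eqP YE : expeR (lne (ge0_cond_exp P (F n) (X n.+1) w)) ==
    ge0_cond_exp P (F n) (X n.+1) w by rewrite lneK_eq.
by rewrite /phi -lee_expeR YE.
Qed.

(* X n.+1 = +oo where E n.+1 = 0, and X n.+1 is integrable. *)
Let E_gt0 : {ae P, forall w n, 0 < E n.+1 w}.
Proof.
apply: ae_foralln => n.
have Xint : P.-integrable setT (X n.+1).
  apply/integrableP; split; first exact: measurable_X.
  under eq_integral do rewrite gee0_abs//.
  have [sF _ _ _] := hF; have [F0 FD _] := sF n.
  have FT : F n setT by rewrite -(setD0 setT); exact: FD.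
  apply: (le_lt_trans (@integral_X_le n setT _)) => //.
  by rewrite integral_cst//= probability_setT mule1 ltry.
apply: filterS (integrable_ae measurableT Xint) => w /(_ I).
rewrite lt_neqAle E_ge0 andbT; apply: contraTneq => E0.
rewrite /X /logE -E0 /= lexx addNye.
by rewrite gt0_muleNy ?lte_fin.
Qed.

Let M n w := \prod_(1 <= k < n.+1) ((expR (- b k))%:E * X k w).

Let MS n w : M n.+1 w = M n w * ((expR (- b n.+1))%:E * X n.+1 w).
Proof. by rewrite /M big_nat_recr. Qed.

Let M_ge0 n w : 0 <= M n w.
Proof. by apply: prode_ge0 => k _; rewrite mule_ge0// lee_fin expR_ge0. Qed.

Let G_measurable_M n : G_measurable (F n) (M n).
Proof.
have [_ _ monoF _] := hF.
elim: n => [|n IH].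
  rewrite (_ : M 0%N = cst 1); first exact: measurable_cst.
  by apply/funext => w; rewrite /M big_geq.
rewrite (_ : M n.+1 = fun w => M n w * ((expR (- b n.+1))%:E * X n.+1 w)); last first.
  by apply/funext => w; exact: MS.
apply: emeasurable_funM; first exact: (G_measurableS (monoF _ _ (leqnSn n)) IH).
by apply: measurable_funeM; exact: G_measurable_X.
Qed.

(** All of [M n.+1] except [X n.+1] is [F n]-measurable and goes into the weight [Z]. Replacing
    [X n.+1] by e^b under this weight cancels the compensating factor e^(-b). *)
Let M_super n A : F n A ->
  \int[P]_(w in A) M n.+1 w <= \int[P]_(w in A) M n w.
Proof.
have [sF _ _ _] := hF.
move=> FA; rewrite !(integral_mkcond A).
pose Z w := M n w * (\1_A w)%:E * (expR (- b n.+1))%:E.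
rewrite [leLHS](_ : _ = \int[P]_w (Z w * X n.+1 w)); last first.
  apply: eq_integral => w _; rewrite epatch_indic MS /Z -!muleA; congr (_ * _).
  by rewrite [RHS]muleC -muleA.
rewrite [leRHS](_ : _ = \int[P]_w (Z w * (expR (b n.+1))%:E)); last first.
  apply: eq_integral => w _; rewrite epatch_indic /Z -!muleA; congr (_ * _).
  by rewrite -EFinM -expRD addNr expR0 mulr1.
apply: (@le_integral_mul _ _ _ (F n) P (X n.+1) (cst (expR (b n.+1))%:E) Z) => //.
- by move=> w; rewrite lee_fin expR_ge0.
- by move=> B FB; exact: integral_X_le.
- apply: emeasurable_funM => //; apply: emeasurable_funM.
    exact: G_measurable_M.
  apply/measurable_EFinP/measurable_indic.
  rewrite -[measurable _]/(<<s F n >> A).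
  by rewrite (sigma_algebra_id (sF n)).
- by move=> w; rewrite !mule_ge0// lee_fin ?expR_ge0.
Qed.

(* Without positivity the identity fails where some E k = 0 and another is +oo,
   since 0 * +oo = 0. *)
Let M_wealth n w : (forall k, 0 < E k.+1 w) ->
  0 < wealth E n w /\
  M n w = expeR (- (s%:E * (lne (wealth E n w) - (\sum_(1 <= k < n.+1) c k w)%:E))
                 - (\sum_(1 <= k < n.+1) b k)%:E).
Proof.
move=> Ew; elim: n => [|n [W_gt0 IH]].
  rewrite /wealth /M !big_geq// lne1 !sube0 mule0 oppe0 expeR0.
  by split.
have WS : wealth E n.+1 w = wealth E n w * E n.+1 w by rewrite /wealth big_nat_recr.
split; first by rewrite WS mule_gt0.
rewrite MS IH WS lneM ?in_itv/= ?W_gt0 ?Ew ?leey//.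
rewrite !(@big_nat_recr _ _ _ n.+1)//= /X /logE.
rewrite -[(expR _)%:E]/(expeR (- b n.+1)%:E) -!expeRD; congr expeR.
(* Neither logarithm is -oo, so as soon as one of them is +oo, both exponents are -oo. *)
have sy : s%:E * +oo = +oo by rewrite gt0_muley ?lte_fin.
have := lne_neqNy W_gt0; have := lne_neqNy (Ew n).
case: (lne (E n.+1 w)) => [y| |] //; case: (lne (wealth E n w)) => [x| |] // _ _.
- by rewrite -!(EFinD, EFinN, EFinM); congr (_%:E); ring.
- by rewrite !addye// !sy.
- by rewrite !addey// !addye// !sy.
- by rewrite !addye// !sy.
Qed.

Lemma measurable_wealth n : measurable_fun setT (wealth E n).
Proof.
elim: n => [|n IH].
  rewrite (_ : wealth E 0%N = cst 1); first exact: measurable_cst.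
  by apply/funext => w; rewrite /wealth big_geq.
rewrite (_ : wealth E n.+1 = fun w => wealth E n w * E n.+1 w); last first.
  by apply/funext => w; rewrite /wealth big_nat_recr.
by apply: emeasurable_funM => //; exact: G_measurable_measurable (@FM n.+1) (@mE n).
Qed.

Lemma measurable_lne_wealth_gt (a : nat -> R) :
  measurable [set w | forall t, (a t)%:E < lne (wealth E t w)].
Proof.
rewrite (_ : [set w | _] = \bigcap_t [set w | (a t)%:E < lne (wealth E t w)]).
  apply: bigcapT_measurable => t; rewrite -[X in measurable X]setTI.
  apply: emeasurable_fun_o_infty => //.
  exact: (measurableT_comp (@measurable_lne R) (@measurable_wealth t)).
by apply/seteqP; split => w H t *; exact: H.
Qed.

Lemma time_uniform_lower_bound (C B : nat -> R) (delta : R) :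
  drift_lower_bound P c C -> (forall t, (\sum_(1 <= k < t.+1) b k <= B t)%R) ->
  (0 < delta)%R ->
  (1 - delta)%:E <= P [set w | forall t,
    (C t - B t / s - ln (delta^-1) / s)%:E < lne (wealth E t w)].
Proof.
move=> hC hB d0.
set S := [set w | _].
have mS : measurable S by exact: measurable_lne_wealth_gt.
have dV : (0 < delta^-1)%R by rewrite invr_gt0.
set U := [set w | exists n, (delta^-1)%:E <= M n w].
have mU : measurable U.
  rewrite (_ : U = \bigcup_n [set w | (delta^-1)%:E <= M n w]); last first.
    by apply/seteqP; split => [w [n H]|w [n _ H]]; exists n.
  apply: bigcup_measurable => n _; rewrite -[X in measurable X]setTI.
  apply: emeasurable_fun_c_infty => //.
  exact: G_measurable_measurable (@FM n) (@G_measurable_M n).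
have PU : P U <= delta%:E.
  have := ville hF G_measurable_M M_ge0 M_super dV (mu := P).
  rewrite -/U (_ : \int[P]_w M 0%N w = 1); last first.
    under eq_integral do rewrite /M big_geq//.
    by rewrite integral_cst// mul1e; exact: probability_setT.
  by rewrite lee_pdivrMl// mule1.
(* Off a null set all bets are positive and the drift bounds hold for all t at once; there, a path
   on which [M] never reaches 1/delta satisfies the lower bound at every time. *)
have PSU : P (~` S) <= P U.
  apply: ae_le_measure => //; first exact: measurableC.
  apply: filterS2 E_gt0 (ae_foralln hC) => w Ew Cw nS.
  apply: contrapT => nU; apply: nS => t.
  have [W0 Mt] := M_wealth t Ew.
  have : M t w < (delta^-1)%:E by rewrite ltNge; apply/negP => H; apply: nU; exists t.
  have dE : (delta^-1)%:E = expeR (ln delta^-1)%:E by rewrite /= lnK.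
  rewrite Mt dE lte_expeR.
  have := lne_neqNy W0; case: (lne _) => [x| |]//= _; last by rewrite ltry.
  rewrite !lte_fin => H.
  (* With the division by [s] cleared, the claim is linear in the product of [s] and the drift
     surplus, whose sign is supplied next. *)
  rewrite -addrA -opprD -mulrDl ltrBlDr -ltrBlDl ltr_pdivlMr//.
  have : (0 <= s * (\sum_(1 <= k < t.+1) c k w - C t))%R.
    by rewrite mulr_ge0 ?subr_ge0 ?(ltW s_gt0)//; exact: Cw.
  by have := hB t; lra.
rewrite -(setCK S) probability_setC; last exact: measurableC.
by rewrite EFinB leeB// (le_trans PSU PU).
Qed.

End tilted_wealth.

(** * Legendre transform of the quadratic v s^2 / 2 *)

Section gaussian.
Context (R : realType).
Implicit Types (v x s : R).

(** Completing the square exhibits, for v > 0, both the value of the supremum over s and its only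
    maximiser x / v. *)
Lemma gaussian_legendre v x s : v != 0%R ->
  (s * x - v * s ^+ 2 / 2 = x ^+ 2 / (2 * v) - v / 2 * (s - x / v) ^+ 2)%R.
Proof. by move=> v0; field. Qed.

Lemma rate_gaussian v x : (0 <= v)%R -> (0 <= x)%R ->
  rate +oo (fun s => (v * s ^+ 2 / 2)%:E) x = gaussian_rate v x.
Proof.
move=> v_ge0 x_ge0; rewrite /gaussian_rate /rate.
have tilt s : (0 <= s)%R -> tilts +oo s by move=> s0; split => //; rewrite ltry.
have [->|v_neq0] := eqVneq v 0%R.
  have [->|x_neq0] := eqVneq x 0%R.
    apply/le_anti/andP; split.
      by apply: ge_ereal_sup => _ [s _ <-]; rewrite mulr0 !mul0r sube0.
    apply: ereal_sup_ubound; exists 0%R; first exact: tilt.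
    by rewrite mulr0 !mul0r sube0.
  (* For v = 0 the objective is s x, which takes the arbitrary positive value [A] at s = A / x. *)
  apply/eqyP => A A0; apply: ereal_sup_ubound; exists (A / x)%R.
    by apply: tilt; rewrite divr_ge0// ltW.
  by rewrite !mul0r sube0 divfK.
have v_gt0 : (0 < v)%R by rewrite lt_def v_neq0.
apply/le_anti/andP; split.
  apply: ge_ereal_sup => _ [s _ <-] /=; rewrite lee_fin gaussian_legendre//.
  by rewrite gerBl mulr_ge0 ?sqr_ge0// divr_ge0.
apply: ereal_sup_ubound; exists (x / v)%R; first by apply: tilt; rewrite divr_ge0.
by rewrite /= -EFinB gaussian_legendre// subrr expr0n/= mulr0 subr0.
Qed.

Lemma optimising_tilt_gaussian v x s : (0 < v)%R -> (0 <= x)%R ->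
  optimising_tilt +oo (fun s => (v * s ^+ 2 / 2)%:E) x s <-> s = (x / v)%R.
Proof.
move=> v_gt0 x_ge0; have v_neq0 : v != 0%R by rewrite gt_eqF.
have tiltE : tilts +oo (x / v)%R.
  by split; rewrite ?ltry// divr_ge0// ltW.
split => [[_ /(_ _ tiltE)]|->].
  (* Optimality against x / v forces the subtracted square to be nonpositive, which gives
     uniqueness. *)
  rewrite -!EFinB lee_fin !gaussian_legendre// subrr expr0n/= mulr0 subr0.
  rewrite lerDl oppr_ge0 => H; apply/eqP; rewrite -subr_eq0 -sqrf_eq0 eq_le sqr_ge0 andbT.
  by move: H; rewrite pmulr_rle0// divr_gt0.
split => // s' _; rewrite -!EFinB lee_fin !gaussian_legendre// subrr expr0n/=.
by rewrite mulr0 subr0 gerBl mulr_ge0 ?sqr_ge0// divr_ge0// ltW.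
Qed.

End gaussian.

(** * The first crossing time and the miss probabilities *)

Lemma stop_time_le (R : realType) (d : measure_display) (T : measurableType d)
    (E : nat -> T -> \bar R) (alpha : R) (t : nat) (w : T) :
  stop_time E alpha w <= t%:R%:E <->
  exists2 k, (1 <= k <= t)%N & (alpha^-1)%:E < wealth E k w.
Proof.
split => [H|[k /andP[k1 kt] Wk]].
  apply: contrapT => nex.
  (* Times are integers: without a crossing up to t the infimum is at least t + 1, so its attainment
     need not be discussed. *)
  have : t.+1%:R%:E <= stop_time E alpha w.
    apply/ereal_infP => _ [k /= [k1 Wk] <-]; rewrite lee_fin ler_nat ltnNge.
    by apply/negP => kt; apply: nex; exists k; rewrite ?k1.
  by move=> /le_trans/(_ H); rewrite lee_fin ler_nat ltnn.
apply: (@le_trans _ _ k%:R%:E); last by rewrite lee_fin ler_nat.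
by apply: ereal_inf_lbound; exists k.
Qed.

Section first_crossing.
Context (R : realType) (d : measure_display) (T : measurableType d).
Variables (P : probability T R) (E : nat -> T -> \bar R) (alpha : R).
Hypothesis mW : forall t, measurable_fun setT (wealth E t).

Lemma measurable_miss t : measurable [set w | wealth E t w <= (alpha^-1)%:E].
Proof. by rewrite -[X in measurable X]setTI; exact: emeasurable_fun_infty_c. Qed.

Lemma measurable_stop_time_le t :
  measurable [set w | stop_time E alpha w <= t%:R%:E].
Proof.
rewrite (_ : [set w | _] = \bigcup_(k in [set k | (1 <= k <= t)%N])
    [set w | (alpha^-1)%:E < wealth E k w]).
  apply: bigcup_measurable => k _; rewrite -[X in measurable X]setTI.
  exact: emeasurable_fun_o_infty.
apply/seteqP; split => w.
  by move=> /stop_time_le[k kt Wk]; exists k.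
by move=> [k kt Wk]; apply/stop_time_le; exists k.
Qed.

Lemma stop_miss_probE t :
  stop_miss_prob P E t alpha = 1 - P [set w | stop_time E alpha w <= t%:R%:E].
Proof.
rewrite -probability_setC; last exact: measurable_stop_time_le.
congr (P _); apply/seteqP; split => w /=; first by rewrite ltNge => /negP.
by move=> /negP; rewrite -ltNge.
Qed.

(** A wealth above 1/alpha at time t stops the clock by t; [1 <= t] makes t admissible in the
    infimum. *)
Lemma stop_miss_prob_le t : (1 <= t)%N ->
  stop_miss_prob P E t alpha <= miss_prob P E t alpha.
Proof.
move=> t1; apply: le_measure; rewrite ?inE; [|exact: measurable_miss|].
  rewrite (_ : [set w | _] = ~` [set w | stop_time E alpha w <= t%:R%:E]).
    exact/measurableC/measurable_stop_time_le.
  apply/seteqP; split => w /=; first by rewrite ltNge => /negP.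
  by move=> /negP; rewrite -ltNge.
move=> w /=; rewrite ltNge => /negP nS; rewrite leNgt; apply/negP => Wt.
by apply: nS; apply/stop_time_le; exists t; rewrite ?t1 ?leqnn.
Qed.

End first_crossing.

(** * Wealth bounds under sub-Gaussian increments *)

Section sub_gaussian.
Context (R : realType) (d : measure_display) (T : measurableType d).
Variables (F : nat -> set (set T)) (P : probability T R).
Variables (E : nat -> T -> \bar R) (c : nat -> T -> R) (sigma2 : nat -> R).
Hypotheses (hF : filtration F).
Hypothesis mE : forall n, G_measurable (F n.+1) (E n.+1).
Hypothesis E_ge0 : forall n w, 0 <= E n.+1 w.
Hypothesis mc : forall n, G_measurable (F n) (c n.+1).
Hypothesis sigma2_ge0 : forall n, (0 <= sigma2 n.+1)%R.
Hypothesis hphi : forall n s, (0 <= s)%R -> {ae P, forall w,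
  phi P F E c n.+1 s w <= (sigma2 n.+1 * s ^+ 2 / 2)%:E}.

Lemma variance_ge0 (V : nat -> R) t :
  (\sum_(1 <= n < t.+1) sigma2 n <= V t)%R -> (0 <= V t)%R.
Proof.
(* The sum starts at 1, and [sigma2] is known to be nonnegative only at successors. *)
apply: le_trans; rewrite big_nat_cond; apply: sumr_ge0 => -[|n] //.
Qed.

Lemma sum_gaussian_le (V : nat -> R) s t :
  (\sum_(1 <= n < t.+1) sigma2 n <= V t)%R ->
  (\sum_(1 <= n < t.+1) sigma2 n * s ^+ 2 / 2 <= V t * s ^+ 2 / 2)%R.
Proof.
by move=> hV; rewrite -!big_distrl/= !ler_wpM2r ?sqr_ge0// invr_ge0.
Qed.

Lemma sub_gaussian_time_uniform (C V : nat -> R) (s delta : R) :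
  drift_lower_bound P c C -> (forall t, (\sum_(1 <= n < t.+1) sigma2 n <= V t)%R) ->
  (0 < s)%R -> (0 < delta)%R ->
  (1 - delta)%:E <= P [set w | forall t,
    (C t - s * V t / 2 - ln (delta^-1) / s)%:E < lne (wealth E t w)].
Proof.
move=> hC hV s0 d0.
have := time_uniform_lower_bound hF s0 mE E_ge0 mc
  (fun n => @hphi n s (ltW s0)) hC (fun t => @sum_gaussian_le V s t (hV t)) d0.
suff E1 t : (V t * s ^+ 2 / 2 / s = s * V t / 2)%R.
  by under eq_set do under eq_forall do rewrite E1.
by field; rewrite gt_eqF.
Qed.

Lemma miss_prob_le (C V : nat -> R) (alpha : R) t : (0 < alpha)%R ->
  drift_lower_bound P c C -> (forall t, (\sum_(1 <= n < t.+1) sigma2 n <= V t)%R) ->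
  miss_prob P E t alpha <= expeR (- gaussian_rate (V t) (excess C alpha t)).
Proof.
move=> a0 hC hV.
have mW := measurable_wealth hF mE.
have Vt0 : (0 <= V t)%R := variance_ge0 (hV t).
have x0 : (0 <= excess C alpha t)%R by rewrite /excess le_max lexx orbT.
rewrite -rate_gaussian//.
have miss_ge0 : 0 <= miss_prob P E t alpha by exact: measure_ge0.
have /eqP <- : expeR (lne (miss_prob P E t alpha)) == miss_prob P E t alpha.
  by rewrite lneK_eq.
(* In the form rate <= - lne (miss_prob), the supremum over s is taken termwise,
   which also covers V t = 0. *)
rewrite lee_expeR leeNr; apply: ge_ereal_sup => _ [s [s0 _] <-] /=.
rewrite leeNr -lee_expeR.
have /eqP -> : expeR (lne (miss_prob P E t alpha)) == miss_prob P E t alpha.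
  by rewrite lneK_eq.
set g := (s * excess C alpha t - V t * s ^+ 2 / 2)%R.
rewrite -[- _]/((- g)%:E) /=.
(* For g <= 0 the bound e^(-g) is at least 1. Otherwise both [s] and the excess must be positive, so
   the excess is C_t - ln (1/alpha) without truncation. *)
have [g0|g0] := leP g 0%R.
  apply: (@le_trans _ _ 1); first exact/probability_le1/measurable_miss.
  by rewrite lee_fin -expR0 ler_expR oppr_ge0.
have s_gt0 : (0 < s)%R.
  rewrite lt_def s0 andbT; apply: contraTneq g0 => sE.
  by rewrite /g sE expr0n/= mulr0 !mul0r subr0 ltxx.
have x_gt0 : (0 < excess C alpha t)%R.
  rewrite lt_def x0 andbT; apply: contraTneq g0 => x0E.
  by rewrite /g x0E mulr0 sub0r oppr_gt0 -leNgt divr_ge0// mulr_ge0// sqr_ge0.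
have xE : excess C alpha t = (C t - ln alpha^-1)%R.
  by move: x_gt0; rewrite /excess lt_max ltxx orbF => ?; rewrite max_l// ltW.
(* The choice delta = e^(-g) makes the lower bound at time t exactly ln (1/alpha). *)
have := sub_gaussian_time_uniform hC hV s_gt0 (expR_gt0 (- g)).
rewrite expRN invrK expRK.
set S := [set w | _] => PS.
have PC : P S <= P (~` [set w | wealth E t w <= (alpha^-1)%:E]).
  apply: le_measure; rewrite ?inE.
  - exact: (measurable_lne_wealth_gt hF mE).
  - exact/measurableC/measurable_miss.
  - move=> w /(_ t) /=.
    have -> : (C t - s * V t / 2 - g / s = ln alpha^-1)%R.
      by rewrite /g xE; field; rewrite gt_eqF.
    move=> aW; apply/negP; rewrite -ltNge.
    have [W0|W0] := leP (wealth E t w) 0.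
      by move: aW; rewrite le0_lneNy.
    have aV : (0 < alpha^-1)%R by rewrite invr_gt0.
    move: aW; rewrite -lne_EFin// lte_lne// in_itv/= leey andbT ?lee_fin ltW//.
have fin_miss : miss_prob P E t alpha \is a fin_num.
  by rewrite fin_num_measure//; exact: measurable_miss.
have := le_trans PS PC; rewrite probability_setC; last exact: measurable_miss.
by rewrite -/(miss_prob P E t alpha) -(fineK fin_miss) -EFinB !lee_fin; lra.
Qed.

End sub_gaussian.

Theorem corollary4p23 (R : realType) (d : measure_display)
    (T : measurableType d) (F : nat -> set (set T)) (P0 P1 : probability T R)
    (E : nat -> T -> \bar R) (c : nat -> T -> R)
    (C V sigma2 : nat -> R)
    (hF : filtration F) (hP : locally_dominated F P1 P0)
    (hE : betting_sequence P0 F E) (hc : drift_certificate P1 F E c)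
    (C0 : C 0%N = 0%R) (hC : drift_lower_bound P1 c C)
    (sigma2_ge0 : forall n, (0 <= sigma2 n.+1)%R)
    (hphi : forall n s, (0 <= s)%R -> {ae P1, forall w,
       phi P1 F E c n.+1 s w <= (sigma2 n.+1 * s ^+ 2 / 2)%:E})
    (V0 : V 0%N = 0%R)
    (hV : forall t, (\sum_(1 <= n < t.+1) sigma2 n <= V t)%R) :
  let psi := fun n s (_ : T) => (sigma2 n * s ^+ 2 / 2)%:E in
  let Psi := fun t s => (V t * s ^+ 2 / 2)%:E in
  [/\ [/\ majorant P1 F E c +oo psi,
          aggregate P1 c +oo psi C Psi,
          (forall t x, (0 <= x)%R -> rate +oo (Psi t) x = gaussian_rate (V t) x) &
          (forall t alpha, (0 < alpha < 1)%R -> (0 < V t)%R ->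
             forall s, optimising_tilt +oo (Psi t) (excess C alpha t) s <->
                       s = (excess C alpha t / V t)%R)],
      (forall t alpha, (1 <= t)%N -> (0 < alpha < 1)%R ->
         stop_miss_prob P1 E t alpha <= miss_prob P1 E t alpha /\
         miss_prob P1 E t alpha
           <= expeR (- gaussian_rate (V t) (excess C alpha t))),
      (forall s delta, (0 < s)%R -> (0 < delta < 1)%R ->
         (1 - delta)%:E <= P1 [set w | forall t,
           (C t - s * V t / 2 - ln (delta^-1) / s)%:E < lne (wealth E t w)]) &
      (forall c' sigma2' : R, (0 < c')%R ->
         (forall n w, c n.+1 w = c') -> (forall n, sigma2 n.+1 = sigma2') ->
         forall alpha delta, (0 < alpha < 1)%R -> (0 < delta < 1)%R ->
         (1 - delta)%:E <= P1 [set w | stop_time E alpha w <=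
           ((Num.ceil (2 * ln (alpha^-1) / c'
               + 2 * sigma2' / c' ^+ 2 * ln (delta^-1)))%:~R)%:E])].
Proof.
move=> psi Psi.
have mE n : G_measurable (F n.+1) (E n.+1) by have [] := hE n.
have E_ge0 n w : 0 <= E n.+1 w by have [_ + _] := hE n; exact.
have mc n : G_measurable (F n) (c n.+1) by have [] := hc n.
have mW := measurable_wealth hF mE.
have Vge0 t : (0 <= V t)%R := variance_ge0 sigma2_ge0 (hV t).
split.
- split.
  + move=> n; split => [w|s [s0 _]]; first by rewrite /psi expr0n/= mulr0 mul0r.
    split; [|exact: measurable_cst|exact: hphi].
    by move=> w; rewrite /psi lee_fin divr_ge0// mulr_ge0// sqr_ge0.
  + split => // t s _; apply: aeW => w.
    by rewrite /psi sumEFin lee_fin sum_gaussian_le.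
  + by move=> t x x0; exact: rate_gaussian.
  + move=> t alpha _ Vt s; apply: optimising_tilt_gaussian => //.
    by rewrite /excess le_max lexx orbT.
- move=> t alpha t1 /andP[a0 _]; split; first exact: stop_miss_prob_le.
  exact: (miss_prob_le hF mE E_ge0 mc sigma2_ge0 hphi).
- move=> s delta s0 /andP[d0 _].
  exact: (sub_gaussian_time_uniform hF mE E_ge0 mc hphi).
- move=> c' sigma2' c'0 cE sigma2E alpha delta /andP[a0 a1] /andP[d0 d1].
  have s'0 : (0 <= sigma2')%R by rewrite -(sigma2E 0%N).
  have l_gt0 : (0 < ln alpha^-1)%R by rewrite ln_gt0// invf_gt1.
  have ld_gt0 : (0 < ln delta^-1)%R by rewrite ln_gt0// invf_gt1.
  set N := (X in Num.ceil X).
  (* Positivity makes the ceiling a natural time [t.+1], hence at least 1, as [stop_miss_prob_le]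
     requires. *)
  have N_gt0 : (0 < N)%R.
    rewrite /N ltr_pwDl// ?divr_gt0 ?mulr_gt0//.
    by rewrite mulr_ge0 ?(ltW ld_gt0)// divr_ge0 ?sqr_ge0// mulr_ge0.
  have Nle := ceil_ge N.
  have : (0 < Num.ceil N)%R by rewrite ceil_gt0.
  move: Nle; case: (Num.ceil N) => [[|t]|]// Nle _.
  rewrite -[(t.+1%:~R)%R]/(t.+1%:R)%R in Nle *.
  (* The given [C] and [V] may be loose; constant drift and variance allow the exact sums c' t and
     sigma2' t instead. *)
  have hC' : drift_lower_bound P1 c (fun t => c' * t%:R)%R.
    move=> k; apply: aeW => w; rewrite big_add1/=.
    under eq_bigr do rewrite cE.
    by rewrite sumr_const_nat subn0 mulr_natr.
  have hV' k : (\sum_(1 <= n < k.+1) sigma2 n <= sigma2' * k%:R)%R.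
    rewrite big_add1/=; under eq_bigr do rewrite sigma2E.
    by rewrite sumr_const_nat subn0 mulr_natr.
  have := miss_prob_le hF mE E_ge0 mc sigma2_ge0 hphi t.+1 a0 hC' hV'.
  set x := excess _ _ _ => miss_le.
  have M_gt0 : (0 < t.+1%:R :> R)%R by rewrite ltr0n.
  move: M_gt0 Nle miss_le; rewrite /x {x}; set M := (t.+1%:R)%R => M_gt0 Nle miss_le.
  (* The inequality [N <= M] multiplied by c'^2. It gives c' M >= 2 ln (1/alpha), so the excess at M
     is positive. *)
  have cM : (2 * ln alpha^-1 * c' + 2 * sigma2' * ln delta^-1 <= c' ^+ 2 * M)%R.
    rewrite [leRHS]mulrC -ler_pdivrMr ?exprn_gt0//; apply: le_trans Nle.
    by rewrite le_eqVlt /N; apply/orP; left; apply/eqP; field; rewrite gt_eqF.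
  have sd_ge0 : (0 <= sigma2' * ln delta^-1)%R by rewrite mulr_ge0// ltW.
  have x_gt0 : (0 < c' * M - ln alpha^-1)%R.
    by rewrite -(pmulr_rgt0 _ c'0); nra.
  have rate_le : expeR (- gaussian_rate (sigma2' * M)
      (excess (fun t => c' * t%:R)%R alpha t.+1))
      <= delta%:E.
    rewrite /excess -/M (max_l (ltW x_gt0)) /gaussian_rate -/M (gt_eqF x_gt0).
    (* At zero variance a positive excess has rate +oo, and the bound is 0. *)
    have [_|sM_neq0] := eqVneq (sigma2' * M)%R 0%R; first by rewrite /= lee_fin ltW.
    have sM_gt0 : (0 < sigma2' * M)%R by rewrite lt_def sM_neq0 mulr_ge0// ltW.
    rewrite -EFinN /= lee_fin -[X in (_ <= X)%R](lnK d0) ler_expR lerNl.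
    rewrite -[X in (X <= _)%R]lnV ?posrE// ler_pdivlMr; last exact: mulr_gt0.
    (* M times [cM], plus the square of ln (1/alpha), gives (c' M - ln (1/alpha))^2 >= 2 sigma2' M
       ln (1/delta). *)
    have : (0 <= M * (c' ^+ 2 * M - (2 * ln alpha^-1 * c' + 2 * sigma2' * ln delta^-1)))%R.
      by rewrite mulr_ge0 ?subr_ge0// ltW.
    by have := sqr_ge0 (ln alpha^-1); nra.
  have := le_trans (stop_miss_prob_le P1 alpha mW (ltn0Sn t)) (le_trans miss_le rate_le).
  rewrite stop_miss_probE// => PS.
  have fin_stop : P1 [set w | stop_time E alpha w <= M%:E] \is a fin_num.
    by rewrite fin_num_measure//; exact: measurable_stop_time_le.
  by move: PS; rewrite -(fineK fin_stop) -EFinB !lee_fin; lra.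
Qed.
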